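(* Let $\mathcal X,\mathcal Y$ be convex sets and let $u_1,u_2:\mathcal X\times\mathcal Y\to[-1,1]$ be the loss functions of a two-player (general-sum) game, with $u_1(\cdot,y)$ convex for every $y\in\mathcal Y$ and $u_2(x,\cdot)$ convex for every $x\in\mathcal X$. Suppose that the OCO algorithms $\mathsf{Alg}_x$ (on $\mathcal X$) and $\mathsf{Alg}_y$ (on $\mathcal Y$) guarantee worst-case alternating regret bounds $\mathrm{Reg}^x_{\mathrm{Alt}}$ and $\mathrm{Reg}^y_{\mathrm{Alt}}$ respectively over $T$ rounds. Run the alternating learning dynamic for $T$ rounds, producing $x_1,\dots,x_T$ and $y_1,\dots,y_T$, and let $x_{T+1}$ be the output of $\mathsf{Alg}_x$ after the loss functions $u_1(\cdot,y_1),\dots,u_1(\cdot,y_T)$. Then the uniform distribution over $\{(x_t,y_t),(x_{t+1},y_t)\}_{t=1,\dots,T}$ is an $\varepsilon$-coarse correlated equilibrium with $\varepsilon=\mathcal O\!\left(\frac{\max\{\mathrm{Reg}^x_{\mathrm{Alt}},\mathrm{Reg}^y_{\mathrm{Alt}}\}}{T}\right)$.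
   Context: OCO (online convex optimization) and alternating regret: an OCO algorithm on a convex set $\mathcal Z$ outputs, for each $t\ge1$, a point $z_t\in\mathcal Z$ as a function of the past convex loss functions $f_1,\dots,f_{t-1}:\mathcal Z\to\mathbb R$ (so $z_1$ is its output on the empty sequence, and $z_{T+1}$ is its output after seeing $f_1,\dots,f_T$). Its alternating regret over $T$ rounds is $\max_{u\in\mathcal Z}\left\{\sum_{t=1}^T\big(f_t(z_t)+f_t(z_{t+1})\big)-2\sum_{t=1}^T f_t(u)\right\}$. A worst-case alternating regret bound is an upper bound on this quantity that holds for every sequence of convex losses $f_1,\dots,f_T$ with values in $[-1,1]$. Alternating learning dynamic: for $t=1,\dots,T$, first $\mathsf{Alg}_x$ decides $x_t\in\mathcal X$ using the past loss functions $u_1(\cdot,y_1),\dots,u_1(\cdot,y_{t-1})$; then $\mathsf{Alg}_y$ decides $y_t\in\mathcal Y$ using the loss functions $u_2(x_1,\cdot),\dots,u_2(x_{t-1},\cdot)$ and also $u_2(x_t,\cdot)$. A probability distribution $\mathcal P$ on $\mathcal X\times\mathcal Y$ is an $\varepsilon$-coarse correlated equilibrium if $\mathbb E_{(x,y)\sim\mathcal P}[u_1(x,y)]\le \min_{x'\in\mathcal X}\mathbb E_{(x,y)\sim\mathcal P}[u_1(x',y)]+\varepsilon$ and $\mathbb E_{(x,y)\sim\mathcal P}[u_2(x,y)]\le\min_{y'\in\mathcal Y}\mathbb E_{(x,y)\sim\mathcal P}[u_2(x,y')]+\varepsilon$. *)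

(* Defs.v *)
From HB Require Import structures.
From mathcomp Require Import all_boot all_order all_algebra.
From mathcomp Require Import all_classical all_reals all_analysis.

Set Implicit Arguments.
Unset Strict Implicit.
Unset Printing Implicit Defensive.

Import Order.TTheory GRing.Theory Num.Theory.
Import numFieldNormedType.Exports.

Local Open Scope classical_set_scope.
Local Open Scope ring_scope.

(* Loss functions on a convex set Z are represented by total functions E -> R
   that are only constrained on Z. *)

(* The argument of [play] is the list of past losses, oldest first. *)
Record oco_alg (R : realType) (E : lmodType R) (Z : set E) := OcoAlg {
  play :> seq (E -> R) -> E ;
  play_in : forall fs : seq (E -> R),
    (forall i, (i < size fs)%N -> convex_function Z (nth (fun=> 0) fs i)) ->
    Z (play fs) }.

(* With f t the loss of round t >= 1 (f 0 is unused), this is z_t: the output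
   after f 1, ..., f (t - 1). *)
Definition iterate (R : realType) (E : lmodType R) (Z : set E)
    (A : oco_alg Z) (f : nat -> E -> R) (t : nat) : E :=
  A [seq f s | s <- index_iota 1 t].

(* The maximum over u is a supremum: it need not be attained on Z. *)
Definition alt_regret (R : realType) (E : lmodType R) (Z : set E)
    (A : oco_alg Z) (T : nat) (f : nat -> E -> R) : \bar R :=
  ereal_sup [set (\sum_(1 <= t < T.+1)
                     (f t (iterate A f t) + f t (iterate A f t.+1))
                  - 2 * \sum_(1 <= t < T.+1) f t u)%:E | u in Z].

Definition alt_regret_bound (R : realType) (E : lmodType R) (Z : set E)
    (A : oco_alg Z) (T : nat) (Reg : R) : Prop :=
  forall f : nat -> E -> R,
    (forall t, (1 <= t <= T)%N -> convex_function Z (f t)) ->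
    (forall t, (1 <= t <= T)%N -> forall z, Z z -> -1 <= f t z <= 1) ->
    (alt_regret A T f <= Reg%:E)%E.

(* x is constrained up to round T + 1, y up to round T; y_t already uses
   the loss u2(x_t, .) of its own round. *)
Definition alternating_dynamic (R : realType) (E F : lmodType R)
    (X : set E) (Y : set F) (u1 u2 : E -> F -> R)
    (Algx : oco_alg X) (Algy : oco_alg Y) (T : nat)
    (x : nat -> E) (y : nat -> F) : Prop :=
  (forall t, (1 <= t <= T.+1)%N ->
     x t = Algx [seq u1 ^~ (y s) | s <- index_iota 1 t]) /\
  (forall t, (1 <= t <= T)%N ->
     y t = Algy [seq u2 (x s) | s <- index_iota 1 t.+1]).

(* An alias of E * F: a bare lmodType has no canonical [point], which
   measurable types require. *)
Definition profile (R : realType) (E F : lmodType R) : Type := (E * F)%type.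

HB.instance Definition _ (R : realType) (E F : lmodType R) :=
  Choice.on (profile E F).
HB.instance Definition _ (R : realType) (E F : lmodType R) :=
  isPointed.Build (profile E F) (0, 0).

(* P is a probability on E * F, for the sigma-algebra generated by G,
   concentrated on X `*` Y. *)
Definition is_CCE (R : realType) (E F : lmodType R) (X : set E) (Y : set F)
    (u1 u2 : E -> F -> R) (eps : R) (G : set (set (profile E F)))
    (P : probability (g_sigma_algebraType G) R) : Prop :=
  [/\ P (X `*` Y) = 1%E,
      ('E_P[fun z => u1 z.1 z.2]
        <= ereal_inf [set 'E_P[fun z => u1 x' z.2] | x' in X] + eps%:E)%E
    & ('E_P[fun z => u2 z.1 z.2]
        <= ereal_inf [set 'E_P[fun z => u2 z.1 y'] | y' in Y] + eps%:E)%E].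

(* Each entry of s has mass 1 / size s, repeated entries accumulating mass.
   For s = [::] the total mass to normalize is 0 and mnormalize falls back on
   its last argument. *)
Definition uniform_seq d (Z : measurableType d) (R : realType) (s : seq Z) :
    probability Z R :=
  mnormalize (msum (fun i => \d_(nth point s i)) (size s)) \d_point.

(* All subsets are measurable, so expectations of arbitrary losses make sense
   for the finitely supported distribution below. *)
Definition alternating_play (R : realType) (E F : lmodType R) (T : nat)
    (x : nat -> E) (y : nat -> F) :
    probability (g_sigma_algebraType (@discrete_measurable (profile E F))) R :=
  uniform_seq (Z := g_sigma_algebraType (@discrete_measurable (profile E F))) R
    ([seq (x t, y t) | t <- index_iota 1 T.+1]
       ++ [seq (x t.+1, y t) | t <- index_iota 1 T.+1]).

(* Main.v *)
(* The x-player's deviations are controlled directly by the alternating regret.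
   For the y-player, z_(t+1) = y_t, so u2(x_(t+1), y_t) is the loss of round t + 1
   at z_(t+1), and the sum of the deviations is the alternating regret up to the
   boundary terms [g z_(T+1) - g u] and [g u - g z_1], with g the loss of round
   T + 1, resp. of round 1.  These are bounded by a multiple of the regret bound
   itself: if some convex g : Y -> [-1, 1] is not constant, then some line through
   z_1 = A [::] leaves Y, and for a suitable p on that line the Minkowski gauge of
   Y centred at p is at least 1/3 at z_1.  Playing this gauge at every round gives
   an alternating regret of at least 1/3.  If all such g are constant, the
   boundary terms vanish. *)
Require Import Defs.
From mathcomp Require Import all_boot all_order all_algebra.
From mathcomp Require Import all_classical all_reals all_analysis.
From mathcomp Require Import measurable_realfun.
From mathcomp Require Import zify ring lra.

Set Implicit Arguments.
Unset Strict Implicit.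
Unset Printing Implicit Defensive.

Import Order.TTheory GRing.Theory Num.Theory.
Import numFieldNormedType.Exports.

Local Open Scope classical_set_scope.
Local Open Scope ring_scope.

(** * Expectations under the uniform distribution on a finite list *)

Lemma uniform_seqE d (Z : measurableType d) (R : realType) (s : seq Z)
    (A : set Z) : (0 < size s)%N ->
  uniform_seq R s A =
    (((size s)%:R^-1)%:E * \sum_(i < size s) \d_(nth point s i) A)%E.
Proof.
move=> s0; rewrite /uniform_seq /= /mnormalize /=.
have -> : msum (fun i => \d_(nth point s i)) (size s) setT = (size s)%:R%:E :> \bar R.
  rewrite /msum (eq_bigr (fun=> 1%:E)) => [|i _]; last exact: diracT.
  by rewrite sumEFin sumr_const card_ord.
by rewrite /= eqe pnatr_eq0 gtn_eqF//= muleC.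
Qed.

Lemma ge0_integral_uniform_seq d (Z : measurableType d) (R : realType)
    (s : seq Z) (f : Z -> \bar R) : (0 < size s)%N ->
  (forall z, 0 <= f z)%E -> measurable_fun setT f ->
  (\int[uniform_seq R s]_z f z =
    ((size s)%:R^-1)%:E * \sum_(i < size s) f (nth point s i))%E.
Proof.
move=> s0 f0 mf.
have c0 : 0 <= ((size s)%:R^-1 : R) by rewrite invr_ge0 ler0n.
rewrite (eq_measure_integral (mscale (NngNum c0)
    (msum (fun i => \d_(nth point s i)) (size s)))); last first.
  by move=> A mA _; exact: uniform_seqE.
rewrite ge0_integral_mscale//= ge0_integral_measure_sum//=; congr (_ * _)%E.
by apply: eq_bigr => i _; rewrite integral_dirac// diracT mul1e.
Qed.

Lemma expectation_uniform_seq d (Z : measurableType d) (R : realType)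
    (s : seq Z) (f : Z -> R) : (0 < size s)%N -> measurable_fun setT f ->
  ('E_(uniform_seq R s)[f] = ((size s)%:R^-1 * \sum_(z <- s) f z)%:E)%E.
Proof.
move=> s0 mf; have mfE : measurable_fun setT (EFin \o f) by exact/measurable_EFinP.
(* The integrals of the positive and negative parts are finite sums of reals, so their difference
   descends to [R]. *)
rewrite unlock integralE !ge0_integral_uniform_seq//; last 2 first.
- exact: measurable_funeneg.
- exact: measurable_funepos.
have posE z : ((EFin \o f)^\+ z = (Num.max (f z) 0)%:E)%E.
  by rewrite funeposE EFin_max.
have negE z : ((EFin \o f)^\- z = (Num.max (- f z) 0)%:E)%E.
  by rewrite funenegE EFin_max.
under eq_bigr do rewrite posE.
under [X in (_ - _ * X)%E]eq_bigr do rewrite negE.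
rewrite !sumEFin -!EFinM -EFinB -mulrBr -sumrB [in RHS](big_nth point) big_mkord.
congr (_ * _)%:E; apply: eq_bigr => i _.
by case: (leP (f _) 0); case: (leP (- f _) 0); lra.
Qed.

Lemma uniform_seq_supp d (Z : measurableType d) (R : realType) (s : seq Z)
    (A : set Z) : (0 < size s)%N -> (forall z, z \in s -> A z) ->
  uniform_seq R s A = 1%E.
Proof.
move=> s0 sA; rewrite uniform_seqE// (eq_bigr (fun=> 1%:E)) => [|i _]; last first.
  by rewrite diracE mem_set//; apply/sA/mem_nth.
by rewrite sumEFin sumr_const card_ord -EFinM mulVf// pnatr_eq0 gtn_eqF.
Qed.

(** * Minkowski gauges and bounded convex functions *)

Section convexity.
Variables (R : realType) (E : lmodType R) (Y : set E).
Implicit Types (a b p q w z : E) (f : E -> R) (s t k l : R).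

Lemma convex_set_conv a b t : convex_set Y -> Y a -> Y b -> 0 <= t <= 1 ->
  Y (t *: a + (1 - t) *: b).
Proof.
move=> cY Ya Yb /andP[t0 t1].
by have := cY a b (Itv01 t0 t1) (mem_set Ya) (mem_set Yb); rewrite inE.
Qed.

Lemma convex_function_conv f a b t : convex_function Y f -> Y a -> Y b ->
  0 <= t <= 1 -> f (t *: a + (1 - t) *: b) <= t * f a + (1 - t) * f b.
Proof.
move=> cf Ya Yb /andP[t0 t1].
exact: cf (Itv01 t0 t1) a b (mem_set Ya) (mem_set Yb).
Qed.

Lemma convex_functionI f :
  (forall a b t, Y a -> Y b -> 0 <= t <= 1 ->
    f (t *: a + (1 - t) *: b) <= t * f a + (1 - t) * f b) ->
  convex_function Y f.
Proof.
move=> cf t a b /set_mem Ya /set_mem Yb.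
by apply: (cf a b t%:num) => //; rewrite ge0/=.
Qed.

(** The ratios [l] for which [z] lies in the image of [Y] under the dilation of ratio [l] centred at
    [p]. *)
Definition gauge_dilations p z : set R :=
  [set l | 0 < l <= 1 /\ Y (p + l^-1 *: (z - p))].

(* Minkowski gauge of Y centred at p. *)
Definition gauge p z : R := inf (gauge_dilations p z).

Lemma gauge_dilations1 p z : Y z -> gauge_dilations p z 1.
Proof. by move=> Yz; split; rewrite ?ltr01 ?lexx// invr1 scale1r subrKC. Qed.

Lemma gauge_dilations_has_lbound p z : has_lbound (gauge_dilations p z).
Proof. by exists 0 => l [/andP[/ltW]]. Qed.

Lemma gauge_le p z l : gauge_dilations p z l -> gauge p z <= l.
Proof. by apply: ge_inf; exact: gauge_dilations_has_lbound. Qed.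

Lemma gauge_itv p z : Y z -> 0 <= gauge p z <= 1.
Proof.
move=> Yz; apply/andP; split; last exact/gauge_le/gauge_dilations1.
apply: lb_le_inf; first by exists 1; exact: gauge_dilations1.
by move=> l [/andP[/ltW]].
Qed.

Lemma gauge_self p : Y p -> gauge p p = 0.
Proof.
move=> Yp; apply/eqP; rewrite eq_le; have /andP[-> _] := gauge_itv p Yp.
rewrite andbT; apply/ler_addgt0Pr => e e0; rewrite add0r.
(* At [z = p] every ratio in (0, 1] is admissible; the minimum respects the cap at 1. *)
apply: (@le_trans _ _ (Num.min e 1)); last by rewrite ge_min lexx.
apply: gauge_le; split; last by rewrite subrr scaler0 addr0.
by rewrite lt_min e0 ltr01 ge_min lexx orbT.
Qed.

(** If [l] and [m] are nearly optimal ratios for [a] and [b], then [n = s * l + s' * m] is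
    admissible for [s *: a + s' *: b]: the rescaled point is the convex combination of the two
    rescaled points with weights [s * l / n] and [s' * m / n]. *)
Lemma gauge_convex p : convex_set Y -> convex_function Y (gauge p).
Proof.
move=> cY; apply: convex_functionI => a b s Ya Yb /andP[s0].
rewrite -subr_ge0; set s' := 1 - s => s1.
apply/ler_addgt0Pr => e e0.
have dil z : Y z -> exists2 l, gauge_dilations p z l & l < gauge p z + e.
  move=> Yz; apply: inf_adherent => //; split.
    by exists 1; exact: gauge_dilations1.
  exact: gauge_dilations_has_lbound.
have [l [/andP[l0 l1] Yl] la] := dil _ Ya.
have [m [/andP[m0 m1] Ym] mb] := dil _ Yb.
apply: (@le_trans _ _ (s * l + s' * m)); last first.
  have -> : s * gauge p a + s' * gauge p b + e =
            s * (gauge p a + e) + s' * (gauge p b + e) by rewrite /s'; ring.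
  by apply: lerD; apply: ler_wpM2l => //; exact: ltW.
set n := s * l + s' * m.
have n0 : 0 < n.
  rewrite /n /s'; have [->|s_neq0] := eqVneq s 0; first by lra.
  by rewrite ltr_wpDr ?mulr_ge0// ?mulr_gt0// ?lt_neqAle ?(eq_sym 0) ?s_neq0// ltW.
apply: gauge_le; split.
  rewrite n0 /n; have : s * l <= s * 1 by rewrite ler_wpM2l.
  have : s' * m <= s' * 1 by rewrite ler_wpM2l.
  by rewrite /s'; lra.
have w1 : 0 <= s * l / n <= 1.
  rewrite divr_ge0 ?mulr_ge0 ?(ltW l0) ?(ltW n0)//= ler_pdivrMr// mul1r.
  by rewrite lerDl mulr_ge0// ltW.
have := convex_set_conv cY Yl Ym w1.
have -> : 1 - s * l / n = s' * m / n.
  by rewrite -{1}(@divff _ n) ?gt_eqF// -mulrBl {1}/n addrAC subrr add0r.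
set v := (X in Y X -> _); set v' := (X in _ -> Y X); suff -> : v = v' by [].
rewrite /v /v' !scalerDr !scalerA addrACA -scalerDl.
have -> : s * l / n + s' * m / n = 1 by rewrite -mulrDl divff// gt_eqF.
have -> : s * l / n / l = n^-1 * s by field; rewrite !gt_eqF.
have -> : s' * m / n / m = n^-1 * s' by field; rewrite !gt_eqF.
rewrite scale1r; congr (_ + _).
rewrite addrACA -scalerDl -mulrDr; congr (_ + _ *: _).
by rewrite /s' subrKC mulr1.
Qed.

(** An admissible [l < k] would put the point rescaled by [k^-1] on the segment from [p] to the
    point rescaled by [l^-1], hence in [Y]. *)
Lemma gauge_ge p z k : convex_set Y -> Y p -> Y z -> 0 < k ->
  ~ Y (p + k^-1 *: (z - p)) -> k <= gauge p z.
Proof.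
move=> cY Yp Yz k0 NY; apply: lb_le_inf; first by exists 1; exact: gauge_dilations1.
move=> l [/andP[l0 l1] Yl]; rewrite leNgt; apply/negP => lk; apply: NY.
have lk1 : 0 <= l / k <= 1.
  by rewrite divr_ge0 ?(ltW l0) ?(ltW k0)//= ler_pdivrMr// mul1r ltW.
have := convex_set_conv cY Yl Yp lk1.
rewrite scalerDr scalerA addrAC -scalerDl subrKC scale1r.
by have -> : l / k / l = k^-1 by field; rewrite !gt_eqF.
Qed.

(** Along the ray, convexity multiplies the increment [f w - f a] by at least [4 ^+ n], while the
    bounds on [f] cap any increment at 2. Powers of 4 suffice and arise from applying the factor -2
    twice. *)
Lemma bounded_convex_ray f a w : convex_function Y f ->
  (forall z, Y z -> -1 <= f z <= 1) ->
  (forall n, Y (a + (4 ^+ n) *: (w - a))) -> Y a -> f w <= f a.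
Proof.
move=> cf fb Y4 Ya; rewrite leNgt; apply/negP => faw.
have h n : 4 ^+ n * (f w - f a) <= 2.
  have N0 : 0 < 4 ^+ n :> R by rewrite exprn_gt0.
  have N1 : 1 <= 4 ^+ n :> R by rewrite exprn_ege1// ler1n.
  have t01 : 0 <= (4 ^+ n : R)^-1 <= 1.
    by rewrite invr_ge0 ltW//= invf_le1.
  have := convex_function_conv cf (Y4 n) Ya t01.
  rewrite scalerDr scalerA mulVf ?gt_eqF// scale1r addrAC -scalerDl subrKC.
  rewrite scale1r subrKC -(ler_pM2l N0) mulrDr !mulrA mulrBr mulr1.
  rewrite divff ?gt_eqF// mul1r.
  by have /andP[_] := fb _ (Y4 n); have /andP[+ _] := fb _ Ya; lra.
have d0 : 0 < f w - f a by rewrite subr_gt0.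
pose n := Num.bound (2 / (f w - f a)).
have := h n; apply/negP; rewrite -ltNge -ltr_pdivrMr//.
apply: (lt_trans (archi_boundP _)); first by rewrite divr_ge0// ltW.
by rewrite -natrX ltr_nat ltn_expl.
Qed.

(* Otherwise Y contains a + (-2)^n (w - a) for all n, hence the whole line, on
   which the bounded convex function f would be constant. *)
Lemma nonconstant_convex_line f a w : convex_function Y f ->
  (forall z, Y z -> -1 <= f z <= 1) -> Y a -> Y w -> f w != f a ->
  exists2 s, s != 0 &
    Y (a + s *: (w - a)) /\ ~ Y (a + (- 2 * s) *: (w - a)).
Proof.
move=> cf fb Ya Yw; apply: contra_neqP => nex.
have YN s : s != 0 -> Y (a + s *: (w - a)) -> Y (a + (- 2 * s) *: (w - a)).
  by move=> s0 Ys; apply: contrapT => NY; apply: nex; exists s.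
have Y4 n : Y (a + (4 ^+ n) *: (w - a)).
  elim: n => [|n IH]; first by rewrite expr0 scale1r subrKC.
  have n0 : (4 ^+ n : R) != 0 by rewrite expf_neq0// pnatr_eq0.
  have := YN _ _ (YN _ n0 IH); rewrite exprS.
  have -> : - 2 * (- 2 * 4 ^+ n) = 4 * 4 ^+ n :> R by ring.
  by apply; rewrite mulf_neq0// oppr_eq0 pnatr_eq0.
have fwa := bounded_convex_ray cf fb Y4 Ya.
(* The opposite ray: its points are those of the first ray multiplied by -2, so they lie in [Y] as
   well. *)
pose v := a + (- 2) *: (w - a).
have Y4v n : Y (a + (4 ^+ n) *: (v - a)).
  rewrite /v [_ - a]addrAC subrr add0r scalerA mulrC; apply: YN (Y4 n).
  by rewrite expf_neq0// pnatr_eq0.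
have fva := bounded_convex_ray cf fb Y4v Ya.
have Yv : Y v by have := Y4v 0%N; rewrite expr0 scale1r subrKC.
(* [a] is one third of [v] plus two thirds of [w]. As neither value exceeds [f a], convexity forces
   [f w = f a]. *)
have t01 : 0 <= (3^-1 : R) <= 1 by lra.
have := convex_function_conv cf Yv Yw t01.
have -> : 3^-1 *: v + (1 - 3^-1) *: w = a.
  rewrite /v; have := subrKC a w; move: (w - a) => u <-; rewrite !scalerDr scalerA addrACA -!scalerDl subrKC.
  have -> : 3^-1 * (- 2) + (1 - 3^-1) = 0 :> R by field.
  by rewrite scale1r scale0r addr0.
by move: fwa fva => *; apply/eqP; rewrite eq_le; lra.
Qed.

(** Take [p = a + s *: (w - a)]. Dilating [a] about [p] by 3 gives [a + (- 2 * s) *: (w - a)], which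
    is outside [Y]; hence the value 1/3. *)
Lemma nonconstant_convex_gauge f a w : convex_set Y -> convex_function Y f ->
  (forall z, Y z -> -1 <= f z <= 1) -> Y a -> Y w -> f w != f a ->
  exists2 p, Y p & 3^-1 <= gauge p a.
Proof.
move=> cY cf fb Ya Yw /(nonconstant_convex_line cf fb Ya Yw)[s s0 [Yp NYq]].
exists (a + s *: (w - a)) => //; apply: gauge_ge => //.
rewrite invrK opprD addrA subrr sub0r scalerN -addrA -scaleNr scalerA -scalerDl.
by have -> : s + - 3 * s = - 2 * s by ring.
Qed.

End convexity.

(** * Lower bounds on any worst-case alternating regret bound *)

Section alternating_regret.
Variables (R : realType) (E : lmodType R) (Z : set E) (A : oco_alg Z).
Variables (T : nat) (Reg : R).
Hypotheses (T0 : (0 < T)%N) (ARegP : alt_regret_bound A T Reg).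

Lemma play_map_in (f : nat -> E -> R) (r : seq nat) :
  (forall t, t \in r -> convex_function Z (f t)) -> Z (A [seq f t | t <- r]).
Proof.
move=> cf; apply: play_in => i; rewrite size_map => ir.
by rewrite (nth_map 0%N)//; exact/cf/mem_nth.
Qed.

Lemma iterate_in (f : nat -> E -> R) (t : nat) : (t <= T.+1)%N ->
  (forall s, (1 <= s <= T)%N -> convex_function Z (f s)) -> Z (iterate A f t).
Proof.
move=> tT cf; apply: play_map_in => s; rewrite mem_index_iota => /andP[s1 st].
by apply: cf; rewrite s1 -ltnS (leq_trans st).
Qed.

Lemma play_nil_in : Z (A [::]).
Proof. by apply: play_in. Qed.

Lemma alt_regret_le (f : nat -> E -> R) (u : E) :
  (forall t, (1 <= t <= T)%N -> convex_function Z (f t)) ->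
  (forall t, (1 <= t <= T)%N -> forall z, Z z -> -1 <= f t z <= 1) ->
  Z u ->
  \sum_(1 <= t < T.+1) (f t (iterate A f t) + f t (iterate A f t.+1))
    - 2 * \sum_(1 <= t < T.+1) f t u <= Reg.
Proof.
move=> cf fb Zu; rewrite -lee_fin; apply: le_trans (ARegP cf fb).
by apply: ereal_sup_ubound; exists u.
Qed.

(** Play [f] at every round: the comparator [u] costs 0 and all terms are nonnegative, so the regret
    is at least the very first term, the loss at the output chosen before any loss is seen. *)
Lemma alt_regret_ge_first (f : E -> R) (u : E) : convex_function Z f ->
  (forall z, Z z -> 0 <= f z <= 1) -> Z u -> f u = 0 -> f (A [::]) <= Reg.
Proof.
move=> cf fb Zu fu0.
have := @alt_regret_le (fun=> f) u (fun _ _ => cf) _ Zu.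
rewrite fu0 [X in 2 * X]big1// mulr0 subr0 => le_Reg; apply: le_trans (le_Reg _); last first.
  by move=> _ _ z /fb; lra.
rewrite big_ltn// /iterate /index_iota subnn /= -addrA lerDl addr_ge0//.
  by have /andP[] // := fb _ (@iterate_in (fun=> f) 2 T0 (fun _ _ => cf)).
rewrite big_nat_cond sumr_ge0// => t /andP[/andP[t2 tT] _].
have Zt s : (s <= T.+1)%N -> 0 <= f (iterate A (fun=> f) s).
  by move=> sT; have /andP[] := fb _ (@iterate_in (fun=> f) s sT (fun _ _ => cf)).
by rewrite addr_ge0// Zt// ltnW.
Qed.

Lemma alt_regret_ge0 : 0 <= Reg.
Proof.
apply: (@alt_regret_ge_first (fun=> 0) (A [::])) => //; last exact: play_nil_in.
  by apply: convex_functionI => a b t _ _ _; rewrite !mulr0 addr0.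
by move=> z _; rewrite lexx ler01.
Qed.

(** If [g a] and [g b] differ, one of them differs from the value of [g] at [A [::]], so a gauge
    loss forces [Reg] to be at least 1/3. The oscillation of [g] is at most 2, which is 6 times
    1/3. *)
Lemma oscillation_le (g : E -> R) (a b : E) : convex_set Z ->
  convex_function Z g -> (forall z, Z z -> -1 <= g z <= 1) -> Z a -> Z b ->
  g a - g b <= 6 * Reg.
Proof.
move=> cZ cg gb Za Zb; have Reg0 := alt_regret_ge0.
have [->|gab] := eqVneq (g a) (g b); first by rewrite subrr mulr_ge0.
have [w Zw gw] : exists2 w, Z w & g w != g (A [::]).
  have [gaA|] := eqVneq (g a) (g (A [::])); last by exists a.
  by exists b => //; rewrite -gaA eq_sym.
have [p Zp] := nonconstant_convex_gauge cZ cg gb play_nil_in Zw gw.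
have := alt_regret_ge_first (gauge_convex p cZ) (gauge_itv p) Zp (gauge_self Zp).
have /andP[] := gb _ Za; have /andP[] := gb _ Zb; lra.
Qed.

End alternating_regret.

(** * Feasibility of the dynamic and expectations under its play *)

Section dynamic.
Variables (R : realType) (E F : lmodType R) (X : set E) (Y : set F).
Variables (u1 u2 : E -> F -> R) (Algx : oco_alg X) (Algy : oco_alg Y).
Variables (T : nat) (x : nat -> E) (y : nat -> F).
Hypotheses (cu1 : forall b, Y b -> convex_function X (u1 ^~ b))
           (cu2 : forall a, X a -> convex_function Y (u2 a))
           (dyn : alternating_dynamic u1 u2 Algx Algy T x y).

(** An algorithm stays in its set only on convex losses, so both players are handled in one
    induction following the order of play: [x t] relies on earlier [y s], then [y t] relies on the
    [x s] up to and including [x t]. *)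
Lemma alternating_dynamic_in t :
  ((1 <= t <= T.+1)%N -> X (x t)) /\ ((1 <= t <= T)%N -> Y (y t)).
Proof.
have [dx dy] := dyn; elim/ltn_ind: t => t IH.
have Xt : (1 <= t <= T.+1)%N -> X (x t).
  move=> t1; rewrite dx//; apply: (@play_map_in _ _ _ _ (fun s => u1 ^~ (y s))) => s.
  rewrite mem_index_iota => /andP[s1 st]; apply/cu1/(IH s st).2.
  by lia.
split=> // t1; rewrite dy//; apply: (@play_map_in _ _ _ _ (fun s => u2 (x s))) => s.
rewrite mem_index_iota => /andP[s1]; rewrite ltnS leq_eqVlt => /predU1P[->|st].
  by apply/cu2/Xt; lia.
by apply/cu2/(IH s st).1; lia.
Qed.

Lemma alternating_play_supp : (0 < T)%N -> alternating_play T x y (X `*` Y) = 1%E.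
Proof.
move=> T0; apply: uniform_seq_supp.
  by rewrite size_cat !size_map size_iota; lia.
move=> z; rewrite mem_cat => /orP[] /mapP[t]; rewrite mem_index_iota => tT ->.
  by split; [apply: (alternating_dynamic_in t).1|apply: (alternating_dynamic_in t).2]; lia.
by split; [apply: (alternating_dynamic_in t.+1).1|apply: (alternating_dynamic_in t).2]; lia.
Qed.

Lemma expectation_alternating_play (f : E -> F -> R) : (0 < T)%N ->
  ('E_(alternating_play T x y)[fun z => f z.1 z.2])%E =
  ((T + T)%:R^-1 * (\sum_(1 <= t < T.+1) f (x t) (y t) +
     \sum_(1 <= t < T.+1) f (x t.+1) (y t)))%:E.
Proof.
move=> T0; rewrite expectation_uniform_seq.
- by rewrite size_cat !size_map size_iota subn1 big_cat/= !big_map.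
- by rewrite size_cat !size_map size_iota; lia.
- by move=> _ B mB; apply: sub_sigma_algebra.
Qed.

End dynamic.

(** * The equilibrium inequalities *)

Lemma sum_shift_up (R : zmodType) (T : nat) (h : nat -> R) :
  \sum_(1 <= t < T.+1) h t.+1 =
  \sum_(1 <= t < T.+1) h t + (h T.+1 - h 1%N).
Proof. by rewrite -telescope_sumr// sumrB addrC subrK. Qed.

(** 13 = 1 + 6 + 6: the regret itself and two boundary terms, each at most 6 times the regret bound.
    Averaging over [T + T] profiles halves it. *)
Lemma cce_gap (R : realFieldType) (T : nat) (S S' M : R) : (0 < T)%N ->
  S <= S' + 13 * M ->
  (T + T)%:R^-1 * S <= (T + T)%:R^-1 * S' + 13 / 2 * (M / T%:R).
Proof.
move=> T0 le_S; have T'0 : 0 < T%:R :> R by rewrite ltr0n.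
have -> : 13 / 2 * (M / T%:R) = (T + T)%:R^-1 * (13 * M).
  by rewrite natrD; field; rewrite !lt0r_neq0// addr_gt0.
by rewrite -mulrDr ler_wpM2l.
Qed.

Theorem theorem2 (R : realType) :
  exists2 C : R, 0 < C &
  forall (E F : lmodType R) (X : set E) (Y : set F) (u1 u2 : E -> F -> R)
    (Algx : oco_alg X) (Algy : oco_alg Y) (T : nat) (Regx Regy : R)
    (x : nat -> E) (y : nat -> F),
  convex_set X ->
  convex_set Y ->
  (forall a b, X a -> Y b -> -1 <= u1 a b <= 1) ->
  (forall a b, X a -> Y b -> -1 <= u2 a b <= 1) ->
  (forall b, Y b -> convex_function X (u1 ^~ b)) ->
  (forall a, X a -> convex_function Y (u2 a)) ->
  (0 < T)%N ->
  alt_regret_bound Algx T Regx ->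
  alt_regret_bound Algy T Regy ->
  alternating_dynamic u1 u2 Algx Algy T x y ->
  is_CCE X Y u1 u2 (C * (Num.max Regx Regy / T%:R)) (alternating_play T x y).
Proof.
exists (13 / 2) => [|E F X Y u1 u2 Algx Algy T Regx Regy x y]; first by lra.
move=> cX cY bu1 bu2 cu1 cu2 T0 regx regy dyn.
have Xx t : (1 <= t <= T.+1)%N -> X (x t).
  exact: (alternating_dynamic_in cu1 cu2 dyn t).1.
have Yy t : (1 <= t <= T)%N -> Y (y t).
  exact: (alternating_dynamic_in cu1 cu2 dyn t).2.
have Regx0 := alt_regret_ge0 T0 regx; have Regy0 := alt_regret_ge0 T0 regy.
have Regx_max : Regx <= Num.max Regx Regy by rewrite le_max lexx.
have Regy_max : Regy <= Num.max Regx Regy by rewrite le_max lexx orbT.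
split; first exact: alternating_play_supp cu1 cu2 dyn T0.
- rewrite -leeBlDr//; apply: le_ereal_inf_tmp => _ [u Xu <-]; rewrite leeBlDr//.
  rewrite (expectation_alternating_play _ _ u1)//.
  rewrite (expectation_alternating_play _ _ (fun=> u1 u))// -EFinD lee_fin.
  apply: cce_gap => //.
  (* The iterates on these losses are the [x t], up to [x T.+1], so the regret against [u] is
     exactly the gap to bound; nonnegativity of the maximum absorbs the factor 13. *)
  have := alt_regret_le regx (f := fun t => u1 ^~ (y t)) _ _ Xu.
  rewrite big_split/= => /(_ (fun t tT => cu1 _ (Yy t tT)))
    /(_ (fun t tT z Xz => bu1 _ _ Xz (Yy t tT))).
  rewrite [X in X + _ - _](_ : _ = \sum_(1 <= t < T.+1) u1 (x t) (y t)); last first.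
    by apply: eq_big_nat => t tT; rewrite dyn.1//; lia.
  rewrite [X in _ + X - _](_ : _ = \sum_(1 <= t < T.+1) u1 (x t.+1) (y t)); last first.
    by apply: eq_big_nat => t tT; rewrite dyn.1//; lia.
  lra.
- rewrite -leeBlDr//; apply: le_ereal_inf_tmp => _ [u Yu <-]; rewrite leeBlDr//.
  rewrite (expectation_alternating_play _ _ u2)//.
  rewrite (expectation_alternating_play _ _ (fun a _ => u2 a u))// -EFinD lee_fin.
  apply: cce_gap => //.
  pose g t := u2 (x t); pose z := iterate Algy g.
  (* The range includes round [T.+1], whose loss [u2 (x T.+1)] appears after the shift although the
     regret bound only covers [T] rounds. *)
  have cg t : (1 <= t <= T.+1)%N -> convex_function Y (g t).
    by move=> tT; exact/cu2/Xx.
  have bg t : (1 <= t <= T.+1)%N -> forall b, Y b -> -1 <= g t b <= 1.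
    by move=> tT b Yb; apply: bu2 => //; exact: Xx.
  have leT t : (1 <= t <= T)%N -> (1 <= t <= T.+1)%N by lia.
  (* [y t] has already seen the loss of round [t], so it is the iterate of index [t.+1]; the initial
     iterate [z 1] is never played. *)
  have zS t : (1 <= t <= T)%N -> z t.+1 = y t by move=> tT; rewrite dyn.2.
  have Yz t : (t <= T.+1)%N -> Y (z t).
    by move=> tT; apply: iterate_in tT _ => s /leT; exact: cg.
  have := alt_regret_le regy (fun t tT => cg t (leT t tT))
    (fun t tT => bg t (leT t tT)) Yu.
  rewrite -/z big_split/=.
  rewrite [X in _ + X - _](_ : _ = \sum_(1 <= t < T.+1) u2 (x t) (y t)); last first.
    by apply: eq_big_nat => t tT; rewrite zS.
  have shift_z := sum_shift_up T (fun t => g t (z t)).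
  have shift_u := sum_shift_up T (fun t => g t u).
  have -> : \sum_(1 <= t < T.+1) u2 (x t.+1) (y t) =
      \sum_(1 <= t < T.+1) g t.+1 (z t.+1).
    by apply: eq_big_nat => t tT; rewrite zS.
  rewrite shift_z shift_u.
  have osc t a b : (1 <= t <= T.+1)%N -> Y a -> Y b -> g t a - g t b <= 6 * Regy.
    by move=> tT; apply: (oscillation_le T0 regy cY (cg t tT) (bg t tT)).
  (* Passing from u2(x_(t+1), y_t) to the loss of round t + 1 at z_(t+1) leaves
     only the two boundary terms t = 1 and t = T + 1. *)
  have := osc T.+1 (z T.+1) u (leqnn _) (Yz _ (leqnn _)) Yu.
  have := osc 1%N u (z 1%N) isT Yu (Yz 1%N isT).
  rewrite /g; lra.
Qed.
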